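(* Let $2\le n\le\infty$ and let $\omega$ be a state on $\mathcal{O}_n$. Assume that there exists a sequence $(a_i)_{i\ge1}$ of isometries in $\mathcal{O}_n^+$ which satisfies $$\omega(a_1\cdots a_l\,a_k^*\cdots a_1^* )=\delta_{lk}\quad\text{for all } l,k\ge1.$$ Then $\omega$ is properly infinitely correlated.
   Context: For $2\le n\le\infty$, $\mathcal{O}_n$ is the Cuntz algebra with Cuntz generators $s_1,\ldots,s_n$ (a sequence $s_1,s_2,\ldots$ if $n=\infty$): the universal unital C*-algebra generated by elements with $s_i^*s_j=\delta_{ij}I$ and $\sum_{i=1}^n s_is_i^*=I$ if $n<\infty$, respectively $\sum_{i=1}^k s_is_i^*\le I$ for all $k\geq 1$ if $n=\infty$. When $n=\infty$, $\{1,\ldots,n\}$ means $\{1,2,\ldots\}$. Let $\mathcal{I}_n=\bigcup_{l\ge0}\{1,\ldots,n\}^l$ be the set of finite words, $\{1,\ldots,n\}^0=\{\emptyset\}$, $s_J=s_{j_1}\cdots s_{j_l}$ for $J=(j_1,\ldots,j_l)$, $s_\emptyset=I$. $\mathcal{O}_n^+$ denotes the norm-closed linear span of $\{s_J: J\in\mathcal{I}_n, J\ne\emptyset\}$ in $\mathcal{O}_n$. An isometry is an element $a$ with $a^*a=I$. For states $\omega,\omega'$ on $\mathcal{O}_n$, write $\omega\sim\omega'$ if their GNS representations are unitarily equivalent. For a state $\omega$ with GNS representation $(\mathcal{H},\pi,\Omega)$, let $\mathcal{K}(\omega)$ be the closed linear span of $\{\pi(s_J)^*\Omega: J\in\mathcal{I}_n\}$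 in $\mathcal{H}$, $\mathrm{c}\dim\omega:=\dim\mathcal{K}(\omega)\in\{1,2,\ldots,\infty\}$ (Hilbert space dimension), and $\kappa(\omega):=\min\{\mathrm{c}\dim\omega':\omega'\text{ a state on }\mathcal{O}_n,\ \omega'\sim\omega\}$. A state $\omega$ is properly infinitely correlated if $\kappa(\omega)=\infty$. *)

(* Defs.v *)
From HB Require Import structures.
From mathcomp Require Import all_boot all_order all_algebra.
From mathcomp Require Import sesquilinear.
From mathcomp Require Import all_classical all_reals all_analysis.
From mathcomp Require Export complex.

Set Implicit Arguments.
Unset Strict Implicit.
Unset Printing Implicit Defensive.

Import Order.TTheory GRing.Theory Num.Theory.
Import numFieldNormedType.Exports.

Local Open Scope classical_set_scope.
Local Open Scope ring_scope.

(* Unital C*-algebras.  The scalars are a [numClosedFieldType] only so that the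
   hierarchy is generic; everything below is used with [R[i]], [R : realType].
   The norm of a [normedModType C] takes its values in (the nonnegative reals
   of) [C].  HB cannot add a join of rings and normed modules below
   [numDomainType], so that the product is part of the mixin and the MathComp
   ring and algebra structures of a C*-algebra are derived from it. *)
HB.mixin Record CompleteNormedModule_isCStar (C : numClosedFieldType) A
    of CompleteNormedModule C A := {
  cstar_one : A ;
  cstar_mul : A -> A -> A ;
  star : A -> A ;
  cstar_mulA : associative cstar_mul ;
  cstar_mul1l : left_id cstar_one cstar_mul ;
  cstar_mul1r : right_id cstar_one cstar_mul ;
  cstar_mulDl : left_distributive cstar_mul +%R ;
  cstar_mulDr : right_distributive cstar_mul +%R ;
  cstar_one_neq0 : cstar_one != 0 ;
  cstar_scaleAl : forall (k : C) (x y : A),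
    k *: cstar_mul x y = cstar_mul (k *: x) y ;
  cstar_scaleAr : forall (k : C) (x y : A),
    k *: cstar_mul x y = cstar_mul x (k *: y) ;
  starD : forall x y, star (x + y) = star x + star y ;
  starZ : forall (k : C) x, star (k *: x) = Num.conj k *: star x ;
  starM : forall x y, star (cstar_mul x y) = cstar_mul (star y) (star x) ;
  starK : forall x, star (star x) = x ;
  cstar_normM : forall x y : A, `|cstar_mul x y| <= `|x| * `|y| ;
  cstar_identity : forall x : A, `|cstar_mul (star x) x| = `|x| ^+ 2
}.

#[short(type="cstarAlgType")]
HB.structure Definition CStarAlgebra (C : numClosedFieldType) :=
  { A of CompleteNormedModule_isCStar C A & CompleteNormedModule C A }.

#[non_forgetful_inheritance]
HB.instance Definition _ (C : numClosedFieldType) (A : cstarAlgType C) :=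
  GRing.Zmodule_isNzRing.Build (CStarAlgebra.sort A) (@cstar_mulA C A)
    (@cstar_mul1l C A) (@cstar_mul1r C A) (@cstar_mulDl C A) (@cstar_mulDr C A)
    (@cstar_one_neq0 C A).

#[non_forgetful_inheritance]
HB.instance Definition _ (C : numClosedFieldType) (A : cstarAlgType C) :=
  GRing.Lmodule_isLalgebra.Build C (CStarAlgebra.sort A) (@cstar_scaleAl C A).

#[non_forgetful_inheritance]
HB.instance Definition _ (C : numClosedFieldType) (A : cstarAlgType C) :=
  GRing.Lalgebra_isAlgebra.Build C (CStarAlgebra.sort A) (@cstar_scaleAr C A).

(* Hilbert spaces.  As everywhere in MathComp, [{dot H for Num.conj}] is linear
   in its first argument and conjugate-linear in its second one. *)
HB.mixin Record CompleteNormedModule_isHilbert (C : numClosedFieldType) H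
    of CompleteNormedModule C H := {
  hdot : {dot H for @Num.conj C} ;
  hdot_norm : forall x : H, `|x| ^+ 2 = hdot x x
}.

#[short(type="hilbertType")]
HB.structure Definition Hilbert (C : numClosedFieldType) :=
  { H of CompleteNormedModule_isHilbert C H & CompleteNormedModule C H }.

Definition linspan (K : nzRingType) (V : lmodType K) (S : set V) : set V :=
  [set x | exists (m : nat) (c : 'I_m -> K) (v : 'I_m -> V),
     (forall i, S (v i)) /\ x = \sum_i c i *: v i].

Section CStar.
Variables (C : numClosedFieldType) (A : cstarAlgType C).

Definition cstar_pos (x : A) : Prop := exists z : A, x = star z * z.

Definition cstar_le (x y : A) : Prop := cstar_pos (y - x).

Definition isometry_elt (a : A) : Prop := star a * a = 1.

Record is_cstar_subalg (B : set A) : Prop := IsCStarSubalg {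
  csub_closed : closed B ;
  csub1 : B 1 ;
  csubZD : forall (k : C) x y, B x -> B y -> B (k *: x + y) ;
  csubM : forall x y, B x -> B y -> B (x * y) ;
  csub_star : forall x, B x -> B (star x)
}.

Record is_state (omega : {scalar A}) : Prop := IsState {
  state_pos : forall a, 0 <= omega (star a * a) ;
  state1 : omega 1 = 1
}.

(* The fields say that [rep] is a unital *-homomorphism into the bounded
   operators of [H]; in particular [rep (star a)] is the adjoint of [rep a]. *)
Record representation (H : hilbertType C) := Representation {
  rep :> A -> {linear H -> H} ;
  rep_bounded : forall a, continuous (rep a) ;
  rep_linear : forall (k : C) a b x, rep (k *: a + b) x = k *: rep a x + rep b x ;
  rep1 : forall x, rep 1 x = x ;
  repM : forall a b x, rep (a * b) x = rep a (rep b x) ;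
  rep_star : forall a x y, hdot (rep a x) y = hdot x (rep (star a) y)
}.

Record gns (omega : {scalar A}) := Gns {
  gns_space : hilbertType C ;
  gns_rep : representation gns_space ;
  gns_vec : gns_space ;
  gns_cyclic : closure [set gns_rep a gns_vec | a in [set: A]] = [set: gns_space] ;
  gns_state : forall a, omega a = hdot (gns_rep a gns_vec) gns_vec
}.

Definition unitarily_equivalent (H H' : hilbertType C)
    (p : representation H) (p' : representation H') : Prop :=
  exists U : {linear H -> H'},
    [/\ set_surj [set: H] [set: H'] U,
        forall x y, hdot (U x) (U y) = hdot x y &
        forall a x, U (p a x) = p' a (U x)].

(* GNS representations exist and are unique up to unitary equivalence, so the
   choice of [G] and [G'] is immaterial. *)
Definition state_equiv (omega omega' : {scalar A}) : Prop :=
  exists (G : gns omega) (G' : gns omega'),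
    unitarily_equivalent (gns_rep G) (gns_rep G').

End CStar.

(* The index n of O_n, 2 <= n <= oo: [Some k] is the finite value k, [None] is
   oo.  The generators s_1, s_2, ... are numbered from 0. *)
Definition cuntz_idx (n : option nat) : eqType :=
  if n is Some k then 'I_k : eqType else nat : eqType.

Definition ge2 (n : option nat) : Prop := if n is Some k then (2 <= k)%N else True.

Section Cuntz.
Variables (C : numClosedFieldType) (n : option nat).

Definition cuntz_sum (A : cstarAlgType C) : (cuntz_idx n -> A) -> Prop :=
  match n return (cuntz_idx n -> A) -> Prop with
  | Some k => fun s => \sum_(i < k) s i * star (s i) = 1
  | None => fun s => forall k, (1 <= k)%N ->
              cstar_le (\sum_(0 <= i < k) s i * star (s i)) 1
  end.

Definition cuntz_relations (A : cstarAlgType C) (s : cuntz_idx n -> A) : Prop :=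
  (forall i j, star (s i) * s j = (i == j)%:R) /\ cuntz_sum s.

(* [A] with the generators [s] is the Cuntz algebra O_n. *)
Record is_cuntz_algebra (A : cstarAlgType C) (s : cuntz_idx n -> A) : Prop :=
  IsCuntzAlgebra {
  cuntz_rel : cuntz_relations s ;
  cuntz_generated : smallest (@is_cstar_subalg C A) (range s) = [set: A] ;
  cuntz_universal : forall (B : cstarAlgType C) (t : cuntz_idx n -> B),
    cuntz_relations t ->
    exists phi : {lrmorphism A -> B},
      (forall a, phi (star a) = star (phi a)) /\ (forall i, phi (s i) = t i)
}.

Variables (A : cstarAlgType C) (s : cuntz_idx n -> A).

Definition word_elt (J : seq (cuntz_idx n)) : A := \prod_(j <- J) s j.

Definition cuntz_plus : set A :=
  closure (linspan [set word_elt J | J in [set J | J <> [::]]]).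

(* K(omega), computed in the GNS representation [G]; the adjoint of the
   operator of s_J is the operator of s_J^*. *)
Definition corr_space (omega : {scalar A}) (G : gns omega) : set (gns_space G) :=
  closure (linspan (range (fun J => gns_rep G (star (word_elt J)) (gns_vec G)))).

End Cuntz.

Arguments cuntz_plus {C n A} s _.
Arguments corr_space {C n A} s {omega} G _.

Section CorrelationDimension.
Variable R : realType.

(* [is_hdim K d]: the closed subspace [K] has an orthonormal basis of
   cardinality [d], all infinite cardinalities being identified with [+oo]. *)
Definition is_hdim (H : hilbertType R[i]) (K : set H) (d : \bar R) : Prop :=
  exists B : set H,
    [/\ forall u v, B u -> B v -> hdot u v = (u == v)%:R,
        closure (linspan B) = K &
        d = counting B].

Variables (n : option nat) (A : cstarAlgType R[i]) (s : cuntz_idx n -> A).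

Definition is_cdim (omega : {scalar A}) (d : \bar R) : Prop :=
  exists G : gns omega, is_hdim (corr_space s G) d.

(* The set is a nonempty subset of {1, 2, ..., +oo}, so that its infimum is a
   minimum. *)
Definition kappa (omega : {scalar A}) : \bar R :=
  ereal_inf [set d | exists omega' : {scalar A},
    [/\ is_state omega', state_equiv omega' omega & is_cdim omega' d]].

Definition properly_infinitely_correlated (omega : {scalar A}) : Prop :=
  kappa omega = +oo%E.

End CorrelationDimension.

(* Main.v *)
Require Import Defs.
From HB Require Import structures.
From mathcomp Require Import all_boot all_order all_algebra.
From mathcomp Require Import sesquilinear.
From mathcomp Require Import all_classical all_reals all_analysis.
From mathcomp Require Import complex.
From mathcomp Require Import ring.
Import Order.TTheory GRing.Theory Num.Theory.
Import numFieldNormedType.Exports.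
Local Open Scope classical_set_scope.
Local Open Scope ring_scope.

Set Implicit Arguments.
Unset Strict Implicit.
Unset Printing Implicit Defensive.

(** Write alpha_l for a_1 ... a_l and N_m for the closed span of the s_W^*
    with W of length at least m.

    Suppose that omega' is equivalent to omega and that K(omega') has finite
    dimension d.  In the GNS space of omega', with cyclic vector Omega', the
    state omega is given by some vector z, and the hypothesis says that the
    vectors alpha_l^* z, l >= 1, are orthonormal.

    Since each a_i is a limit of polynomials in the generators without constant
    term, alpha_l^* belongs to N_l ([clspan_adj_prod]).  Multiplying s_W^* on
    the right by s_J cancels at most the length of J, so for a fixed linear
    combination x of monomials s_J s_K^* the product alpha_l^* x belongs to N_0
    as soon as l is large ([eventually_adj]).  Such x are dense in O_n
    ([clspan_monomials]), so x can be chosen with x Omega' as close to z as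
    desired; as alpha_l is an isometry, alpha_l^* z is then equally close, for
    all large l, to alpha_l^* x Omega', which lies in N_0 Omega', a subset of
    K(omega').  Thus d + 1 orthonormal vectors are
    within an arbitrarily small distance of the d-dimensional space K(omega').
    The d + 1 approximants are linearly dependent ([clspan_dependent]), whereas
    vectors close enough to an orthonormal family are independent
    ([near_orthonormal_free]): a contradiction ([not_finite_corr_space]).

    Passing from approximations in O_n to approximations in the GNS space needs
    the representation to be norm continuous ([rep_norm_le]); this follows from
    positivity, because 1 - h is of the form y^* y when h is self-adjoint and
    small ([one_sub_small_is_square]).

    The GNS triple that witnesses the equivalence of omega' and omega and the
    one in which K(omega') is computed may differ.  Linear relations between the
    vectors a Omega' are nevertheless the same in both, since the norm of
    a Omega' is determined by omega' ([gns_norm_eq]). *)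

(** * Closed linear spans *)

Section ClosedSpan.
Variable C : numFieldType.

Lemma closure_normP (V : normedModType C) (S : set V) (x : V) :
  closure S x <-> forall e : C, 0 < e -> exists2 y, S y & `|x - y| < e.
Proof.
split=> [clSx e e0|h B /nbhs_ballP[e e0 eB]].
  have [y [Sy]] := clSx _ (nbhsx_ballx x e e0).
  by rewrite -ball_normE => xy; exists y.
have [y Sy xy] := h e e0; exists y; split=> //.
by apply: eB; rewrite -ball_normE.
Qed.

Section Linspan.
Variables (V : lmodType C) (S : set V).

Lemma sub_linspan : S `<=` linspan S.
Proof.
by move=> x Sx; exists 1%N, (fun=> 1), (fun=> x); rewrite big_ord1 scale1r.
Qed.

Lemma linspan0 : linspan S 0.
Proof. by exists 0%N, (fun=> 0), (fun=> 0); rewrite big_ord0; split=> // -[]. Qed.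

Lemma linspanZD (k : C) x y :
  linspan S x -> linspan S y -> linspan S (k *: x + y).
Proof.
move=> [m [c [v [Sv ->]]]] [p [d [w [Sw ->]]]].
exists (m + p)%N, (fun i : 'I_(m + p) =>
  match fintype.split i with inl j => k * c j | inr j => d j end).
exists (fun i : 'I_(m + p) => match fintype.split i with inl j => v j | inr j => w j end); split.
  by move=> i; case: (fintype.split i).
rewrite big_split_ord /= scaler_sumr; congr (_ + _); apply: eq_bigr => i _.
  by rewrite (unsplitK (inl i)) scalerA.
by rewrite (unsplitK (inr i)).
Qed.

Lemma linspan_ind (P : set V) : P 0 ->
  (forall (k : C) x y, P x -> P y -> P (k *: x + y)) ->
  S `<=` P -> linspan S `<=` P.
Proof.
move=> P0 PZD SP _ [m [c [v [Sv ->]]]].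
elim/big_rec: _ => // i x _ Px; apply: PZD => //; exact/SP/Sv.
Qed.

End Linspan.

Definition clspan (V : normedModType C) (S : set V) : set V := closure (linspan S).

Section Clspan.
Variable V : normedModType C.
Implicit Types S : set V.

Lemma sub_clspan S : S `<=` clspan S.
Proof. by move=> x Sx; apply/subset_closure/sub_linspan. Qed.

Lemma clspan0 S : clspan S 0.
Proof. exact/subset_closure/linspan0. Qed.

Lemma clspanZD S (k : C) x y :
  clspan S x -> clspan S y -> clspan S (k *: x + y).
Proof.
move=> /closure_normP Sx /closure_normP Sy; apply/closure_normP => e e0.
have k0 : 0 < `|k| + 1 by rewrite ltr_wpDl.
have [x' Sx' xx'] := Sx (e / 2 / (`|k| + 1)) ltac:(by rewrite !divr_gt0).
have [y' Sy' yy'] := Sy (e / 2) ltac:(by rewrite divr_gt0).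
exists (k *: x' + y'); first exact: linspanZD.
rewrite opprD addrACA -scalerBr (le_lt_trans (ler_normD _ _))//.
rewrite (splitr e) ler_ltD// normrZ.
rewrite (@le_trans _ _ ((`|k| + 1) * `|x - x'|))//.
  by rewrite ler_wpM2r// lerDl.
by rewrite mulrC -ler_pdivlMr// ltW.
Qed.

End Clspan.

(** Semilinearity, rather than linearity, so that it also applies to the
    adjoint. *)
Lemma clspan_map (V W : normedModType C) (f : V -> W) (sigma : C -> C) (b : C)
    (S : set V) (T : set W) :
  {morph f : x y / x + y} -> (forall k x, f (k *: x) = sigma k *: f x) ->
  0 <= b -> (forall x, `|f x| <= b * `|x|) ->
  (forall x, S x -> clspan T (f x)) ->
  forall x, clspan S x -> clspan T (f x).
Proof.
move=> fD fZ b0 fb fST x /closure_normP Sx.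
have f0 : f 0 = 0 by apply: (addIr (f 0)); rewrite -fD !add0r.
have fB y z : f (y - z) = f y - f z by apply: (addIr (f z)); rewrite -fD !subrK.
have lin y : linspan S y -> clspan T (f y).
  move: y; apply: linspan_ind => //; first by rewrite f0; exact: clspan0.
  by move=> k y z Ty Tz; rewrite fD fZ; exact: clspanZD.
have : closed (clspan T) by exact: closed_closure.
rewrite closure_id => ->; apply/closure_normP => e e0.
have b1 : 0 < b + 1 by rewrite ltr_wpDl.
have [y Sy xy] := Sx (e / (b + 1)) ltac:(by rewrite divr_gt0).
exists (f y); first exact: lin.
rewrite -fB (le_lt_trans (fb _))//.
rewrite (@le_lt_trans _ _ ((b + 1) * `|x - y|))//.
  by rewrite ler_wpM2r// lerDl.
by rewrite mulrC -ltr_pdivlMr.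
Qed.

End ClosedSpan.

(** * Norm and involution of a C*-algebra *)

Section CStarNorm.
Variables (C : numClosedFieldType) (A : cstarAlgType C).
Implicit Types x y : A.

Lemma starMr x y : star (x * y) = star y * star x.
Proof. exact: starM. Qed.

Lemma normMr_le x y : `|x * y| <= `|x| * `|y|.
Proof. exact: cstar_normM. Qed.

Lemma norm_star_mul x : `|star x * x| = `|x| ^+ 2.
Proof. exact: cstar_identity. Qed.

Lemma star0 : star 0 = 0 :> A.
Proof. by apply: (addIr (star 0)); rewrite -starD !add0r. Qed.

Lemma starN x : star (- x) = - star x.
Proof. by apply: (addIr (star x)); rewrite -starD !addNr star0. Qed.

Lemma starB x y : star (x - y) = star x - star y.
Proof. by rewrite starD starN. Qed.

Lemma star1 : star 1 = 1 :> A.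
Proof. by have := starMr (star 1) (1 : A); rewrite mulr1 starK mulr1. Qed.

Lemma star_prod (I : Type) (r : seq I) (F : I -> A) :
  star (\prod_(i <- r) F i) = \prod_(i <- rev r) star (F i).
Proof.
elim: r => [|i r ih]; first by rewrite !big_nil star1.
by rewrite big_cons starMr ih rev_cons -cats1 big_cat big_seq1.
Qed.

Lemma norm_star x : `|star x| = `|x|.
Proof.
have le_star y : `|y| <= `|star y|.
  have [->|y0] := eqVneq y 0; first by rewrite star0.
  by rewrite -(@ler_pM2r _ `|y|) ?normr_gt0// -expr2 -norm_star_mul normMr_le.
by apply/eqP; rewrite eq_le -{2}(starK x) !le_star.
Qed.

Lemma norm_isometry x : isometry_elt x -> `|x| = 1.
Proof.
have norm1 : `|1 : A| = 1.
  have n0 : `|1 : A| != 0 by rewrite normr_eq0 oner_eq0.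
  by apply: (mulfI n0); rewrite mulr1 -expr2 -norm_star_mul star1 mul1r.
move=> xx; have := norm_star_mul x; rewrite xx norm1 => /esym/eqP.
by rewrite (@pexpr_eq1 _ _ 2)// => /eqP.
Qed.

Lemma isometry_prod (I : eqType) (r : seq I) (F : I -> A) :
  (forall i, i \in r -> isometry_elt (F i)) -> isometry_elt (\prod_(i <- r) F i).
Proof.
move=> hF; rewrite big_seq; elim/big_rec: _ => [|i x ri hx].
  by rewrite /isometry_elt star1 mulr1.
by rewrite /isometry_elt starMr mulrA -(mulrA (star x)) hF// mulr1.
Qed.

End CStarNorm.

(** * Square roots near the unit *)

Section SquareRoot.
Variables (R : realType).
Local Notation C := R[i].

(** The order of R[i] is partial, but a positive element is a real number, so
    that the archimedean property of R applies. *)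
Lemma exists_expn_lt (e : C) : 0 < e -> exists n, 2^-1 ^+ n < e.
Proof.
move=> e0; have : e \is Num.real by rewrite realE ltW.
move=> /RRe_real eE; rewrite -eE ltcR in e0.
have [N _ hN] := near_infty_natSinv_expn_lt (PosNum e0).
exists N; have := hN N (leqnn N) => /=.
rewrite -eE -ltcR; apply: le_lt_trans.
by rewrite div1r -exprVn rmorphXn/= fmorphV/= rmorph_nat.
Qed.

Lemma geometric_cvg (V : completeNormedModType C) (u : nat -> V) :
  (forall k, `|u k.+1 - u k| <= 2^-1 ^+ k) ->
  exists l, forall e : C, 0 < e -> exists N, forall k, (N <= k)%N -> `|l - u k| < e.
Proof.
move=> hu.
have half n : 2^-1 ^+ n.+1 + 2^-1 ^+ n.+1 = 2^-1 ^+ n :> C.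
  by rewrite exprS mulrC -splitr.
(* The telescoping bound, in a form that is stable under induction on [j]. *)
have hd m j : `|u (m + j)%N - u m| <= 2 * 2^-1 ^+ m - 2 * 2^-1 ^+ (m + j).
  elim: j => [|j ih]; first by rewrite addn0 !subrr normr0.
  rewrite addnS -(subrKA (u (m + j)%N)) (le_trans (ler_normD _ _))//.
  rewrite (le_trans (lerD (hu _) ih))// -(half (m + j)%N).
  by rewrite le_eqVlt; apply/orP; left; apply/eqP; ring.
have : cvg (u @ \oo).
  apply/cauchy_cvgP/cauchy_exP => e e0.
  have [N hN] := exists_expn_lt (divr_gt0 e0 (ltr0n C 2)).
  exists (u N); exists N => // k /= Nk.
  rewrite -ball_normE/= distrC -(subnKC Nk) (le_lt_trans (hd _ _))//.
  rewrite (@le_lt_trans _ _ (2 * 2^-1 ^+ N))//.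
    by rewrite gerBl mulr_ge0// exprn_ge0.
  by rewrite mulrC -ltr_pdivlMr.
move=> /cvg_ex[l /cvgrPdist_lt hl]; exists l => e e0.
by have [N _ hN] := hl e e0; exists N => k; exact: hN.
Qed.

Variable A : cstarAlgType C.

(** If u = (h + u^2) / 2 then (1 - u)^2 = 1 - h.  The map u |-> (h + u^2) / 2
    sends the ball of radius 1/2 into itself and contracts it by the factor 1/2,
    and its iterates from 0 are self-adjoint, hence so is its fixed point. *)
Lemma one_sub_small_is_square (h : A) : star h = h -> `|h| <= 4^-1 ->
  exists y, 1 - h = star y * y.
Proof.
move=> hsa hle; pose f (u : A) := 2^-1 *: (h + u * u).
pose u k := iter k f 0.
have uS k : u k.+1 = f (u k) by [].
have half0 : 0 <= 2^-1 :> C by rewrite invr_ge0.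
have quarter : 4^-1 = 2^-1 * 2^-1 :> C by rewrite -invfM -natrM.
have fB x y : f x - f y = 2^-1 *: (x * (x - y) + (x - y) * y).
  by rewrite -scalerBr opprD addrACA subrr add0r mulrBr mulrBl addrA subrK.
have flip x y (b : C) : `|x| + `|y| <= b -> `|f x - f y| <= 2^-1 * (b * `|x - y|).
  move=> xy; rewrite fB normrZ normfV normr_nat ler_wpM2l//.
  rewrite (le_trans (ler_normD _ _))// (le_trans (lerD (normMr_le _ _) (normMr_le _ _)))//.
  by rewrite [`|x - y| * _]mulrC -mulrDl ler_wpM2r.
have ule k : `|u k| <= 2^-1.
  elim: k => [|k ih]; first by rewrite normr0.
  rewrite uS /f normrZ normfV normr_nat -[leRHS]mulr1 ler_wpM2l//.
  rewrite (le_trans (ler_normD _ _))// (@le_trans _ _ (4^-1 + 4^-1))//; last first.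
    by rewrite quarter mulrC -splitr invf_le1// ler1n.
  by rewrite lerD// (le_trans (normMr_le _ _))// quarter ler_pM.
have usa k : star (u k) = u k.
  elim: k => [|k ih]; first exact: star0.
  by rewrite uS /f starZ starD starMr ih hsa fmorphV rmorph_nat.
have [l ul] : exists l, forall e : C, 0 < e -> exists N, forall k, (N <= k)%N -> `|l - u k| < e.
  apply: geometric_cvg => k; elim: k => [|k ih].
    by rewrite subr0 (le_trans (ule 1%N))// expr0 invf_le1// ler1n.
  apply: le_trans (flip (u k.+1) (u k) 1 _) _.
    by rewrite (splitr 1) mul1r lerD ?ule.
  by rewrite exprS mul1r ler_wpM2l.
have eq0 (x : A) : (forall e : C, 0 < e -> `|x| <= e) -> x = 0.
  move=> hx; apply/eqP; have [//|x0] := eqVneq x 0; exfalso.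
  have xp : 0 < `|x| by rewrite normr_gt0.
  have := hx (`|x| / 2) ltac:(by rewrite divr_gt0).
  by rewrite lt_geF// ltr_pdivrMr// ltr_pMr// ltr1n.
have lsa : star l = l.
  apply/eqP; rewrite -subr_eq0; apply/eqP/eq0 => e e0.
  have [N hN] := ul (e / 2) ltac:(by rewrite divr_gt0).
  rewrite -(subrKA (u N)) (le_trans (ler_normD _ _))// (splitr e) lerD//.
    by rewrite -{1}(usa N) -starB norm_star ltW// hN.
  by rewrite distrC ltW// hN.
have lf : l = f l.
  apply/eqP; rewrite -subr_eq0; apply/eqP/eq0 => e e0.
  have [N1 hN1] := ul 1 ltr01.
  have [N2 hN2] := ul (e / 2) ltac:(by rewrite divr_gt0).
  pose N := maxn N1 N2.
  (* A priori the limit is only known to be within 1 of [u N], which suffices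
     for [f] not to increase the distance between them. *)
  have l2 : `|u N| + `|l| <= 2.
    rewrite -(subrK (u N) l) (le_trans (lerD (lexx _) (ler_normD _ _)))//.
    rewrite addrCA (le_trans (lerD (ltW (hN1 N (leq_maxl _ _))) (lerD (ule N) (ule N))))//.
    by rewrite -[X in 1 + (X + X)]mul1r -splitr -(natrD _ 1 1).
  rewrite -(subrKA (u N.+1)) (le_trans (ler_normD _ _))// (splitr e) lerD//.
    by rewrite ltW// hN2// leqW// leq_maxr.
  rewrite uS (le_trans (flip _ _ _ l2))// mulKf ?pnatr_eq0// distrC.
  by rewrite ltW// hN2// leq_maxr.
exists (1 - l); rewrite starB star1 lsa.
have ll : l + l = h + l * l.
  rewrite {1 2}lf /f -scalerDl (_ : 2^-1 + 2^-1 = 1) ?scale1r//.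
  by rewrite [RHS](splitr 1) mul1r.
rewrite mulrBr mulr1 mulrBl mul1r opprB addrA addrAC.
by rewrite -(addrA 1) -opprD ll opprD addrA subrK.
Qed.

End SquareRoot.

(** * Words in the Cuntz generators *)

Section Words.
Variables (C : numClosedFieldType) (n : option nat) (A : cstarAlgType C).
Variable s : cuntz_idx n -> A.
Hypothesis s_ortho : forall i j, star (s i) * s j = (i == j)%:R.
Local Notation w := (word_elt s).
Implicit Types J K L : seq (cuntz_idx n).

Lemma word_nil : w [::] = 1.
Proof. exact: big_nil. Qed.

Lemma word_cons i J : w (i :: J) = s i * w J.
Proof. exact: big_cons. Qed.

Lemma word_cat J K : w (J ++ K) = w J * w K.
Proof. exact: big_cat. Qed.

(** Letters cancel from the left, and the product vanishes at the first
    disagreement. *)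
Lemma star_word_mul_word K L : (size L <= size K)%N ->
  star (w K) * w L = 0 \/
  exists2 J, size J = (size K - size L)%N & star (w K) * w L = star (w J).
Proof.
elim: L K => [|l L ih] [|k K]//= LK.
- by right; exists [::]; rewrite // word_nil mulr1.
- by right; exists (k :: K); rewrite // word_nil mulr1.
rewrite !word_cons starMr mulrA -(mulrA (star (w K))) s_ortho.
have [_|_] := eqVneq k l; last by left; rewrite mulr0 mul0r.
by rewrite mulr1; exact: ih.
Qed.

Lemma star_word_mul_longer_word K L : (size K <= size L)%N ->
  star (w K) * w L = 0 \/ exists J, star (w K) * w L = w J.
Proof.
move=> KL; have e : star (w K) * w L = star (star (w L) * w K).
  by rewrite starMr starK.
rewrite e; have [->|[J _ ->]] := star_word_mul_word KL; first by left; exact: star0.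
by right; exists J; rewrite starK.
Qed.

Definition adj_words (m : nat) : set A :=
  [set star (w J) | J in [set J | (m <= size J)%N]].

Local Notation N m := (clspan (adj_words m)).

Lemma clspan_adj_word J : N (size J) (star (w J)).
Proof. by apply: sub_clspan; exists J => /=. Qed.

Lemma clspan_mull (S T : set A) (a : A) :
  (forall x, S x -> clspan T (a * x)) -> forall x, clspan S x -> clspan T (a * x).
Proof.
move=> ST; apply: (clspan_map (f := fun x => a * x) (sigma := id)
  (b := `|a|)) ST => // [x y|k x|x].
- exact: mulrDr.
- by rewrite scalerAr.
- exact: normMr_le.
Qed.

Lemma clspan_mulr (S T : set A) (a : A) :
  (forall x, S x -> clspan T (x * a)) -> forall x, clspan S x -> clspan T (x * a).
Proof.
move=> ST; apply: (clspan_map (f := fun x : A => x * a) (sigma := id)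
  (b := `|a|)) ST => // [x y|k x|x].
- exact: mulrDl.
- by rewrite scalerAl.
- by rewrite mulrC; exact: normMr_le.
Qed.

Lemma clspan_star (S T : set A) :
  (forall x, S x -> clspan T (star x)) -> forall x, clspan S x -> clspan T (star x).
Proof.
move=> ST; apply: (clspan_map (f := star) (sigma := Num.conj) (b := 1)) ST => // [x y|k x|x].
- exact: starD.
- exact: starZ.
- by rewrite norm_star mul1r.
Qed.

Lemma clspan_mul (S T U : set A) :
  (forall x y, S x -> T y -> clspan U (x * y)) ->
  forall x y, clspan S x -> clspan T y -> clspan U (x * y).
Proof.
move=> STU x y Sx Ty; apply: (clspan_mulr (S := S)) Sx => x' Sx'.
by apply: (clspan_mull (S := T)) Ty => y' Ty'; exact: STU.
Qed.

Lemma clspan_adj_mul m p x y : N m x -> N p y -> N (m + p) (x * y).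
Proof.
apply: clspan_mul => _ _ [J /= mJ <-] [K /= pK <-].
rewrite -starMr -word_cat; apply: sub_clspan; exists (K ++ J) => //=.
by rewrite size_cat addnC leq_add.
Qed.

(** This is where the length grading is used: a word [J] consumes at most
    [size J] letters of each adjoint word. *)
Lemma clspan_adj_mul_word m J x :
  (size J <= m)%N -> N m x -> N 0 (x * w J).
Proof.
move=> Jm; apply: clspan_mulr => _ [K /= mK <-].
have [->|[L _ ->]] := star_word_mul_word (leq_trans Jm mK); first exact: clspan0.
by apply: sub_clspan; exists L.
Qed.

Lemma star_cuntz_plus a : cuntz_plus s a -> N 1 (star a).
Proof.
apply: clspan_star => _ [J /= J0 <-]; apply: sub_clspan; exists J => //=.
by case: J J0.
Qed.

Lemma clspan_adj_prod (a : nat -> A) l :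
  (forall i, (1 <= i)%N -> cuntz_plus s (a i)) ->
  N l (\prod_(i <- rev (index_iota 1 l.+1)) star (a i)).
Proof.
move=> ha; elim: l => [|l ih].
  by rewrite /index_iota big_nil -star1 -word_nil; exact: clspan_adj_word.
have -> : index_iota 1 l.+2 = rcons (index_iota 1 l.+1) l.+1.
  by rewrite /index_iota !subSS !subn0 -{1}(addn1 l) iotaD cats1.
rewrite rev_rcons big_cons -(add1n l); apply: clspan_adj_mul => //.
exact/star_cuntz_plus/ha.
Qed.

(** The normally ordered monomials, whose linear span is the *-algebra generated
    by the [s i]. *)
Definition monomials : set A :=
  [set w J * star (w K) | J in [set: seq (cuntz_idx n)] & K in [set: seq (cuntz_idx n)]].

Lemma monomials_word J K : monomials (w J * star (w K)).
Proof. by exists J => //; exists K. Qed.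

Lemma monomials_mul x y : monomials x -> monomials y -> clspan monomials (x * y).
Proof.
move=> [J _ [K _ <-]] [L _ [M _ <-]].
rewrite mulrA -(mulrA (w J)).
case: (leqP (size L) (size K)) => [LK|/ltnW KL].
  have [->|[I _ ->]] := star_word_mul_word LK.
    by rewrite mulr0 mul0r; exact: clspan0.
  by rewrite -mulrA -starMr -word_cat; exact/sub_clspan/monomials_word.
have [->|[I ->]] := star_word_mul_longer_word KL.
  by rewrite mulr0 mul0r; exact: clspan0.
by rewrite -word_cat; exact/sub_clspan/monomials_word.
Qed.

Lemma clspan_monomials_subalg : is_cstar_subalg (clspan monomials).
Proof.
split.
- exact: closed_closure.
- by apply: sub_clspan; have := monomials_word [::] [::]; rewrite word_nil star1 mulr1.
- by move=> *; exact: clspanZD.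
- exact/clspan_mul/monomials_mul.
- apply: clspan_star => _ [J _ [K _ <-]]; rewrite starMr starK.
  exact/sub_clspan/monomials_word.
Qed.

Lemma clspan_monomials :
  smallest (@is_cstar_subalg C A) (range s) = [set: A] ->
  clspan monomials = [set: A].
Proof.
move=> gen; apply/seteqP; split => // x _.
have : smallest (@is_cstar_subalg C A) (range s) x by rewrite gen.
apply; split; first exact: clspan_monomials_subalg.
move=> _ [i _ <-]; apply: sub_clspan.
by have := monomials_word [:: i] [::]; rewrite word_nil star1 mulr1 word_cons word_nil mulr1.
Qed.

Lemma eventually_adj (b : nat -> A) x :
  (forall l, N l (b l)) -> linspan monomials x ->
  exists m, forall l, (m <= l)%N -> N 0 (b l * x).
Proof.
move=> Nb; move: x; apply: linspan_ind.
- by exists 0%N => l _; rewrite mulr0; exact: clspan0.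
- move=> k x y [m hm] [p hp]; exists (maxn m p) => l.
  rewrite geq_max => /andP[ml pl]; rewrite mulrDr -scalerAr.
  by apply: clspanZD; [exact: hm|exact: hp].
move=> _ [J _ [K _ <-]]; exists (size J) => l Jl; rewrite mulrA.
apply: (@clspan_adj_mul 0 0); first exact: clspan_adj_mul_word (Nb l).
by apply: sub_clspan; exists K.
Qed.

End Words.

(** * Dependent and almost orthonormal families in Hilbert space *)

Section HilbertLinearAlgebra.
Variables (C : numClosedFieldType) (H : hilbertType C).
Implicit Types x y z : H.

(** Some [y] in the span of [B] is at distance less than [`|z|] from [z], unless
    [z] is zero; but if [z] is orthogonal to [y] then that distance is at least
    [`|z|], by Pythagoras. *)
Lemma orthogonal_clspan_eq0 (B : set H) z :
  clspan B z -> (forall b, B b -> hdot z b = 0) -> z = 0.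
Proof.
move=> /closure_normP Bz zB; apply/eqP; rewrite -normr_eq0.
have [//|nz0] := eqVneq `|z| 0.
have [y By zy] := Bz `|z| ltac:(by rewrite lt0r nz0 normr_ge0).
have zy0 : hdot z y = 0.
  move: y By {zy}; apply: linspan_ind => //; first exact: linear0r.
  by move=> k x y zx zy; rewrite linearDr/= linearZr_LR/= zx zy mulr0 addr0.
have : `|z| ^+ 2 <= `|z - y| ^+ 2.
  rewrite !hdot_norm dnormB/= zy0 conjC0 addr0 subr0 lerDl -hdot_norm.
  by rewrite exprn_ge0.
by rewrite ler_pXn2r ?nnegrE// lt_geF.
Qed.

(** A nontrivial element of the left kernel of the matrix of the [hdot (w i) b]
    is a combination orthogonal to [B]. *)
Lemma clspan_dependent (B : seq H) (N : nat) (w : 'I_N -> H) :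
  (size B < N)%N -> (forall i, clspan [set` B] (w i)) ->
  exists2 c : 'I_N -> C, (exists i, c i != 0) & \sum_i c i *: w i = 0.
Proof.
move=> BN Bw; pose M : 'M[C]_(N, size B) := \matrix_(i, j) hdot (w i) B`_j.
have /rowV0Pn[v vM v0] : kermx M != 0.
  rewrite -mxrank_eq0 mxrank_ker subn_eq0 -ltnNge.
  exact: leq_ltn_trans (rank_leq_col M) BN.
exists (fun i => v 0 i).
  by apply/existsP; apply: contraNT v0 => /existsPn v0;
    apply/eqP/rowP => i; rewrite mxE; apply/eqP; rewrite -[_ == _]negbK v0.
apply: (@orthogonal_clspan_eq0 [set` B]).
  elim/big_rec: _ => [|i x _ Bx]; first exact: clspan0.
  exact: clspanZD.
move=> _ /= /(nthP 0)[j jB <-].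
move/sub_kermxP: vM => /rowP/(_ (Ordinal jB)); rewrite !mxE => vM.
rewrite linear_sumlz -[RHS]vM; apply: eq_bigr => i _.
by rewrite linearZl_LR mxE.
Qed.

(** If the sum of the [c i *: w i] vanishes then the sum of the [c i *: v i],
    of square norm T = \sum_i |c i|^2, is that of the [c i *: (v i - w i)],
    whose norm is at most e * \sum_i |c i|, while
    (\sum_i |c i|)^2 <= 2 N T. *)
Lemma near_orthonormal_free (N : nat) (v w : 'I_N -> H) (e : C) :
  (forall i j, hdot (v i) (v j) = (i == j)%:R) ->
  0 <= e -> (forall i, `|v i - w i| <= e) -> e ^+ 2 * (2 * N%:R) < 1 ->
  forall c : 'I_N -> C, \sum_i c i *: w i = 0 -> forall i, c i = 0.
Proof.
move=> vv e0 vw eN c cw.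
pose T : C := \sum_i `|c i| ^+ 2; pose S : C := \sum_i `|c i|.
have T0 : 0 <= T by apply: sumr_ge0 => i _; rewrite exprn_ge0.
have S0 : 0 <= S by apply: sumr_ge0.
have vT : `|\sum_i c i *: v i| ^+ 2 = T.
  rewrite hdot_norm linear_sumlz; apply: eq_bigr => i _.
  rewrite linearZl_LR/= linear_sumr (bigD1 i)//= big1 => [|j ji].
    by rewrite addr0 linearZr_LR/= vv eqxx mulr1 normCK.
  by rewrite linearZr_LR/= vv eq_sym (negPf ji) mulr0.
have TS : T <= e ^+ 2 * S ^+ 2.
  rewrite -vT -exprMn ler_pXn2r ?nnegrE ?mulr_ge0//.
  have -> : \sum_i c i *: v i = \sum_i c i *: (v i - w i).
    by under [RHS]eq_bigr do rewrite scalerBr; rewrite sumrB cw subr0.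
  rewrite (le_trans (ler_norm_sum _ _ _))// mulr_sumr ler_sum// => i _.
  by rewrite normrZ mulrC ler_wpM2r.
have ST : S ^+ 2 <= 2 * N%:R * T.
  have le2 (a b : C) : 0 <= a -> 0 <= b -> a * b <= a ^+ 2 + b ^+ 2.
    move=> a0 b0; rewrite -subr_ge0.
    have -> : a ^+ 2 + b ^+ 2 - a * b = (a - b) ^+ 2 + a * b by ring.
    apply: addr_ge0; last exact: mulr_ge0.
    by rewrite real_exprn_even_ge0// rpredB// ger0_real.
  rewrite expr2 mulr_suml.
  rewrite (@le_trans _ _ (\sum_(i < N) \sum_(j < N) (`|c i| ^+ 2 + `|c j| ^+ 2)))//.
    by rewrite ler_sum// => i _; rewrite mulr_sumr ler_sum// => j _; rewrite le2.
  under eq_bigr do rewrite big_split/= sumr_const card_ord.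
  rewrite big_split/= sumrMnl sumr_const card_ord.
  by rewrite -/T -mulr2n -mulrnA mulnC -[leLHS]mulr_natl natrM.
move=> i; apply/eqP; rewrite -normr_eq0 -sqrf_eq0.
have Ti : `|c i| ^+ 2 <= T.
  by rewrite /T (bigD1 i)//= lerDl sumr_ge0// => j _; rewrite exprn_ge0.
have TT : T <= e ^+ 2 * (2 * N%:R) * T.
  by rewrite -mulrA (le_trans TS)// ler_wpM2l// exprn_ge0.
have /eqP T00 : T == 0.
  apply: contraTT isT => Tn0; have Tp : 0 < T by rewrite lt0r Tn0.
  by move: TT; rewrite -ler_pdivrMr// divff// lt_geF.
by rewrite eq_le exprn_ge0// andbT -T00.
Qed.

End HilbertLinearAlgebra.

(** * Continuity of representations *)

Section Representations.
Variables (R : realType) (A : cstarAlgType R[i]).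
Local Notation C := R[i].

Section Rep.
Variables (H : hilbertType C) (p : representation A H).
Implicit Types (a b : A) (x : H).

Lemma rep0 x : p 0 x = 0.
Proof.
apply: (addIr (p 0 x)); rewrite add0r -[X in X + _]scale1r -rep_linear.
by rewrite scaler0 addr0.
Qed.

Lemma repZ k a x : p (k *: a) x = k *: p a x.
Proof. by rewrite -[k *: a]addr0 rep_linear rep0 addr0. Qed.

Lemma repD a b x : p (a + b) x = p a x + p b x.
Proof. by rewrite -[a]scale1r rep_linear !scale1r. Qed.

Lemma repB a b x : p (a - b) x = p a x - p b x.
Proof. by rewrite repD -scaleN1r repZ scaleN1r. Qed.

Lemma rep_sum (I : Type) (r : seq I) (F : I -> A) x :
  p (\sum_(i <- r) F i) x = \sum_(i <- r) p (F i) x.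
Proof.
elim: r => [|i r ih]; first by rewrite !big_nil rep0.
by rewrite !big_cons repD ih.
Qed.

Lemma norm_rep a x : `|p a x| ^+ 2 = hdot x (p (star a * a) x).
Proof. by rewrite hdot_norm rep_star repM. Qed.

(** For h = a^* a / (2 |a|)^2, of norm 1/4, write 1 - h = y^* y; then
    |x|^2 - |a x|^2 / (2 |a|)^2 = |y x|^2 is nonnegative.  The constant 2 is not
    optimal: a representation is contractive. *)
Lemma rep_norm_le a x : `|p a x| <= 2 * `|a| * `|x|.
Proof.
have [->|a0] := eqVneq a 0; first by rewrite rep0 !normr0 mulr0 mul0r.
have n0 : 0 < `|a| by rewrite normr_gt0.
have k0 : 0 < (2 * `|a|) ^+ 2 by rewrite exprn_gt0// mulr_gt0.
have ik0 : 0 <= ((2 * `|a|) ^+ 2)^-1 by rewrite invr_ge0 ltW.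
pose h := ((2 * `|a|) ^+ 2)^-1 *: (star a * a).
have [||y hy] := @one_sub_small_is_square R A h.
- rewrite /h starZ starMr starK; congr (_ *: _).
  exact: geC0_conj.
- rewrite /h normrZ norm_star_mul normfV (ger0_norm (ltW k0)).
  rewrite exprMn invfM -mulrA mulVf ?mulr1 ?expf_neq0 ?normr_eq0//.
  by rewrite -natrX lexx.
rewrite -(@ler_pXn2r _ 2%N)// ?nnegrE ?mulr_ge0// exprMn norm_rep.
have := exprn_ge0 2 (normr_ge0 (p y x)).
rewrite norm_rep -hy repB rep1 repZ linearBr/= linearZr_LR/= -hdot_norm subr_ge0.
by rewrite (geC0_conj ik0) mulrC ler_pdivrMr// mulrC.
Qed.

Lemma clspan_rep (S : set A) (T : set H) x :
  (forall a, S a -> clspan T (p a x)) -> forall a, clspan S a -> clspan T (p a x).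
Proof.
move=> ST; apply: (clspan_map (f := fun a : A => p a x) (sigma := id)
  (b := 2 * `|x|)) ST => [a b|k a||a].
- exact: repD.
- exact: repZ.
- by rewrite mulr_ge0.
- by rewrite mulrAC; exact: rep_norm_le.
Qed.

End Rep.

(** Lets null combinations of vectors [a Omega] be moved from one GNS triple to
    another, in place of the unitary that intertwines the two. *)
Lemma gns_norm_eq (omega : {scalar A}) (G G' : gns omega) a :
  `|gns_rep G a (gns_vec G)| = `|gns_rep G' a (gns_vec G')|.
Proof.
have norm_gns (K : gns omega) : `|gns_rep K a (gns_vec K)| ^+ 2 = omega (star a * a).
  by rewrite (gns_state K) repM rep_star starK hdot_norm.
apply/eqP; rewrite -(@eqrXn2 _ 2%N)//; apply/eqP.
by rewrite !norm_gns.
Qed.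

End Representations.

(** * States with finite-dimensional correlation space *)

Section FiniteCorrelation.
Variables (R : realType) (n : option nat) (A : cstarAlgType R[i]).
Local Notation C := R[i].
Variable s : cuntz_idx n -> A.
Hypothesis s_ortho : forall i j, star (s i) * s j = (i == j)%:R.
Hypothesis s_gen : smallest (@is_cstar_subalg C A) (range s) = [set: A].
Local Notation N m := (clspan (adj_words s m)).

Lemma adj_corr_space (omega : {scalar A}) (G : gns omega) a :
  N 0 a -> corr_space s G (gns_rep G a (gns_vec G)).
Proof.
by apply: clspan_rep => _ [J _ <-]; apply: sub_clspan; exists J.
Qed.

Lemma monomials_cyclic (omega : {scalar A}) (G : gns omega) z (e : C) : 0 < e ->
  exists2 x, linspan (monomials s) x & `|z - gns_rep G x (gns_vec G)| < e.
Proof.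
move=> e0; set Om := gns_vec G.
have /closure_normP clz : closure [set gns_rep G a Om | a in [set: A]] z.
  by rewrite gns_cyclic.
have [_ [a _ <-] za] := clz (e / 2) ltac:(by rewrite divr_gt0).
have d0 : 0 < 2 * (`|Om| + 1) by rewrite mulr_gt0// ltr_wpDl.
have /closure_normP cla : clspan (monomials s) a by rewrite clspan_monomials.
have [x wx ax] := cla (e / 2 / (2 * (`|Om| + 1))) ltac:(by rewrite !divr_gt0).
exists x => //; rewrite -(subrKA (gns_rep G a Om)) (le_lt_trans (ler_normD _ _))//.
rewrite (splitr e) ltrD// -repB (le_lt_trans (rep_norm_le _ _ _))//.
rewrite (@le_lt_trans _ _ (`|a - x| * (2 * (`|Om| + 1))))//; last by rewrite -ltr_pdivlMr.
by rewrite mulrAC mulrC ler_wpM2l// ler_wpM2l// lerDl.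
Qed.

(** [b l] stands for alpha_l^*, and [z] for the vector of a state equivalent to
    [omega].  The orthonormal vectors are in [G], the dependence comes from
    [G']. *)
Lemma not_finite_corr_space (omega : {scalar A}) (G G' : gns omega)
    (z : gns_space G) (b : nat -> A) (B : set (gns_space G')) :
  (forall l, isometry_elt (star (b l))) -> (forall l, N l (b l)) ->
  (forall l k, (1 <= l)%N -> (1 <= k)%N ->
     hdot (gns_rep G (b l) z) (gns_rep G (b k) z) = (l == k)%:R) ->
  finite_set B -> closure (linspan B) <> corr_space s G'.
Proof.
move=> bi Nb bo /finite_seqP[sB ->] BK.
(* With [M] vectors and distances at most [2 * e], independence of the
   approximants requires [(2 * e) ^+ 2 * (2 * M) < 1]. *)
pose M := (size sB).+1.
have M0 : 0 < M%:R :> C by rewrite ltr0n.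
pose e : C := (4 * M%:R)^-1.
have e0 : 0 < e by rewrite invr_gt0 mulr_gt0.
have [x wx zx] := monomials_cyclic z e0.
have [m hm] := eventually_adj s_ortho Nb wx.
(* The successor keeps the indices positive, where orthonormality is known. *)
pose l (i : 'I_M) := (m + i).+1.
have Nbx i : N 0 (b (l i) * x) by apply: hm; rewrite leqW// leq_addr.
pose w i := gns_rep G (b (l i) * x) (gns_vec G).
have [c [i ci0] cw'] := @clspan_dependent _ _ sB M
  (fun i => gns_rep G' (b (l i) * x) (gns_vec G')) (ltnSn _)
  ltac:(by move=> i; rewrite /clspan BK; exact: adj_corr_space).
have comb (K : gns omega) : \sum_i c i *: gns_rep K (b (l i) * x) (gns_vec K) =
    gns_rep K (\sum_i c i *: (b (l i) * x)) (gns_vec K).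
  by rewrite rep_sum; apply: eq_bigr => j _; rewrite repZ.
have cw : \sum_i c i *: w i = 0.
  by apply/eqP; rewrite comb -normr_eq0 (gns_norm_eq G G') -comb cw' normr0.
move/eqP: ci0; apply.
apply: (near_orthonormal_free (v := fun i => gns_rep G (b (l i)) z) (w := w)
  (e := 2 * e)) cw i => [j k||j|].
- by rewrite bo// eqSS eqn_add2l.
- by rewrite mulr_ge0// ltW.
- rewrite /w repM -linearB (le_trans (rep_norm_le _ _ _))//.
  rewrite -norm_star (norm_isometry (bi _)) mulr1 ler_wpM2l// ltW//.
- have -> : (2 * e) ^+ 2 * (2 * M%:R) = e * 2 * (4 * M%:R * e) by ring.
  rewrite mulfV ?mulr1 ?gt_eqF ?mulr_gt0//.
  rewrite mulrC /e ltr_pdivrMr ?mulr_gt0// mul1r.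
  by rewrite -natrM ltr_nat (@leq_trans (4 * 1)%N)// leq_mul2l.
Qed.

End FiniteCorrelation.

Theorem theorem1p9 (R : realType) (n : option nat) (hn : ge2 n)
  (A : cstarAlgType R[i]) (s : cuntz_idx n -> A) (hs : is_cuntz_algebra s)
  (omega : {scalar A}) (homega : is_state omega)
  (ha : exists a : nat -> A,
     (forall i, (1 <= i)%N -> isometry_elt (a i) /\ cuntz_plus s (a i)) /\
     (forall l k, (1 <= l)%N -> (1 <= k)%N ->
        omega ((\prod_(1 <= i < l.+1) a i) *
               (\prod_(i <- rev (index_iota 1 k.+1)) star (a i))) = (l == k)%:R)) :
  properly_infinitely_correlated s omega.
Proof.
have [a [a_iso a_ortho]] := ha; have [[s_ortho _] s_gen _] := hs.
apply/eqP; rewrite /kappa -leye_eq; apply/le_ereal_inf_tmp => d.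
move=> [omega' [_ [G1 [G [U [U_surj U_isom U_intertw]]]] [G' [B [_ BK ->]]]]].
rewrite /counting; case: asboolP => // Bfin; exfalso.
(* [G1] is the GNS triple of [omega'] joined to that of [omega] by [U]; pull the
   cyclic vector of [omega] back to it. *)
have [z _ zE] := U_surj (gns_vec G) Logic.I.
pose b l := \prod_(i <- rev (index_iota 1 l.+1)) star (a i).
have starb l : star (b l) = \prod_(1 <= i < l.+1) a i.
  by rewrite star_prod revK; apply: eq_bigr => i _; exact: starK.
apply: (not_finite_corr_space s_ortho s_gen (z := z) (b := b)) Bfin BK.
- move=> l; rewrite starb; apply: isometry_prod => i.
  by rewrite mem_index_iota => /andP[i1 _]; exact: (a_iso i i1).1.
- by move=> l; apply: clspan_adj_prod => // i i1; exact: (a_iso i i1).2.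
move=> l k l1 k1; rewrite -U_isom !U_intertw zE.
rewrite -[in X in hdot _ X](starK (b k)) -rep_star -repM -gns_state starb.
by rewrite a_ortho// eq_sym.
Qed.
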